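(* Let $W$ be a finite complex reflection group generated by reflections of order $2$, let $\Bbbk$ be a field of characteristic $0$, and let $\mathcal{H}$, $\mathcal{H}_{\mathrm{gr}}^r$, $\mathcal{H}_{\mathrm{gr}}^{2\infty}$, $\mathcal{H}_{\mathrm{gr}}^{2\infty+1}$ and $\mathcal{H}_{\mathrm{tail}}=\mathcal{H}_{\mathrm{tail}}^0\oplus\mathcal{H}_{\mathrm{tail}}^1$ be as defined in the context. Then $$\mathcal{H}_{\mathrm{tail}}^0 = \Bbbk(h^2)\,\mathcal{H}_{\mathrm{gr}}^{2\infty}\qquad\text{and}\qquad \mathcal{H}_{\mathrm{tail}}^1 = h\,\Bbbk(h^2)\left(Z(\mathcal{H})\oplus \mathcal{H}_{\mathrm{gr}}^{2\infty+1}\right).$$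
   Context: $\mathcal{R}$ is the set of reflections of $W$. The group algebra $\Bbbk W$ is a Lie algebra with bracket $[a,b]=ab-ba$; $\mathcal{H}$ is the Lie $\Bbbk$-subalgebra of $\Bbbk W$ generated by $\mathcal{R}$, and $Z(\mathcal{H})$ is its center. For $r\ge1$, $\mathcal{H}_{\mathrm{gr}}^r\subset\mathcal{H}$ is the $\Bbbk$-linear span of all iterated Lie brackets of $r$ reflections. It is known that $\mathcal{H}_{\mathrm{gr}}^r\subset\mathcal{H}_{\mathrm{gr}}^{r+2}$ for $r\ge2$. Put $\mathcal{H}_{\mathrm{gr}}^{2\infty}=\bigcup_{r\ge1}\mathcal{H}_{\mathrm{gr}}^{2r}$ and $\mathcal{H}_{\mathrm{gr}}^{2\infty+1}=\bigcup_{r\ge1}\mathcal{H}_{\mathrm{gr}}^{2r+1}$. $\mathcal{H}_{\mathrm{tail}}$ is the Lie $\Bbbk(h^2)$-subalgebra of $\Bbbk(h)W$ generated by the elements $hs$, $s\in\mathcal{R}$. It is $\mathbb{Z}/2$-graded, its homogeneous components being $\mathcal{H}_{\mathrm{tail}}^0=\mathcal{H}_{\mathrm{tail}}\cap \Bbbk(h^2)W$ and $\mathcal{H}_{\mathrm{tail}}^1=\mathcal{H}_{\mathrm{tail}}\cap h\Bbbk(h^2)W$. For $V$ a $\Bbbk$-subspace of $\Bbbk((h))W$ and $A$ a $\Bbbk$-subalgebra of $\Bbbk((h))$, $AV$ denotes the image of the natural map $V\otimes_{\Bbbk}A\to\Bbbk((h))W$. *)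

(* Defs.v *)
From HB Require Import structures.
From mathcomp Require Import all_boot all_order all_algebra all_fingroup.
From mathcomp Require Import mxrepresentation.
From mathcomp Require Import boolp classical_sets reals.
From mathcomp Require Import complex.

Set Implicit Arguments.
Unset Strict Implicit.
Unset Printing Implicit Defensive.

Import Order.TTheory GRing.Theory Num.Theory.
Local Open Scope ring_scope.

(* The elements of K W are the coefficient functions W -> K. Scalars are taken
   in K^o to inherit the K-module structure of finite functions; the product is
   convolution, not the pointwise product of {ffun W -> K}. *)
Definition group_algebra (K : comNzRingType) (W : finGroupType) : Type :=
  {ffun W -> K^o}.

Section GroupAlgebra.
Variables (K : comNzRingType) (W : finGroupType).
Implicit Types (a : K) (g : W) (x y z : group_algebra K W).

HB.instance Definition _ :=
  GRing.Lmodule.copy (group_algebra K W) {ffun W -> K^o}.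

Definition gelt g : group_algebra K W := [ffun u => (u == g)%:R].

Definition galg_mul x y : group_algebra K W :=
  [ffun g => \sum_(u : W) x u * y (u^-1 * g)%g].

Fact galg_mulA : associative galg_mul.
Proof.
move=> x y z; apply/ffunP=> g; rewrite !ffunE.
under eq_bigr => u _ do rewrite ffunE mulr_sumr.
under [RHS]eq_bigr => u _ do rewrite ffunE mulr_suml.
rewrite [RHS]exchange_big /=; apply: eq_bigr => u _.
rewrite (reindex_inj (mulgI u^-1%g)) /=; apply: eq_bigr => v _.
by rewrite mulrA invMg invgK -mulgA mulKVg.
Qed.

Fact galg_mul1l : left_id (gelt 1%g) galg_mul.
Proof.
move=> x; apply/ffunP=> g; rewrite ffunE (bigD1 1%g) //= big1 => [|u u1].
  by rewrite ffunE eqxx mul1r invg1 mul1g addr0.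
by rewrite ffunE (negPf u1) mul0r.
Qed.

Fact galg_mul1r : right_id (gelt 1%g) galg_mul.
Proof.
move=> x; apply/ffunP=> g; rewrite ffunE (bigD1 g) //= big1 => [|u ug].
  by rewrite ffunE mulVg eqxx mulr1 addr0.
rewrite ffunE -(inj_eq (mulgI u)) mulKVg mulg1 eq_sym.
by rewrite (negPf ug) mulr0.
Qed.

Fact galg_mulDl : left_distributive galg_mul +%R.
Proof.
move=> x y z; apply/ffunP=> g; rewrite !ffunE -big_split /=.
by apply: eq_bigr => u _; rewrite ffunE mulrDl.
Qed.

Fact galg_mulDr : right_distributive galg_mul +%R.
Proof.
move=> x y z; apply/ffunP=> g; rewrite !ffunE -big_split /=.
by apply: eq_bigr => u _; rewrite ffunE mulrDr.
Qed.

Fact galg_oner_neq0 : gelt 1%g != 0.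
Proof. by apply/eqP=> /ffunP/(_ 1%g)/eqP; rewrite !ffunE eqxx oner_eq0. Qed.

HB.instance Definition _ := GRing.Zmodule_isNzRing.Build (group_algebra K W)
  galg_mulA galg_mul1l galg_mul1r galg_mulDl galg_mulDr galg_oner_neq0.

Fact galg_scalerAl a x y : a *: (x * y) = (a *: x) * y.
Proof.
apply/ffunP=> g; rewrite !ffunE scaler_sumr.
by apply: eq_bigr => u _; rewrite ffunE scalerAl.
Qed.

HB.instance Definition _ :=
  GRing.Lmodule_isLalgebra.Build K (group_algebra K W) galg_scalerAl.

Fact galg_scalerAr a x y : a *: (x * y) = x * (a *: y).
Proof.
apply/ffunP=> g; rewrite !ffunE scaler_sumr.
by apply: eq_bigr => u _; rewrite ffunE scalerAr.
Qed.

HB.instance Definition _ :=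
  GRing.Lalgebra_isAlgebra.Build K (group_algebra K W) galg_scalerAr.

End GroupAlgebra.

Local Open Scope classical_set_scope.

Section Lie.
Variables (K : comNzRingType) (A : algType K).
Implicit Types (S : set K) (U V X : set A).

Definition bracket (x y : A) : A := x * y - y * x.

(* S is meant to be a subring of K, over which A is a module by restriction. *)
Definition is_submodule S U :=
  [/\ U 0, (forall x y, U x -> U y -> U (x + y))
    & (forall a x, S a -> U x -> U (a *: x))].

Definition is_lie_subalgebra S U :=
  is_submodule S U /\ forall x y, U x -> U y -> U (bracket x y).

Definition lspan S X : set A := smallest (is_submodule S) X.

Definition lie_generated S X : set A := smallest (is_lie_subalgebra S) X.

Definition lie_center U : set A :=
  [set z | U z /\ forall x, U x -> bracket z x = 0].

(* Brackets of r elements of X, with any parenthesization. *)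
Inductive iterated_bracket X : nat -> A -> Prop :=
| Iter_elt x of X x : iterated_bracket X 1 x
| Iter_bracket p q x y of iterated_bracket X p x & iterated_bracket X q y :
    iterated_bracket X (p + q)%N (bracket x y).

Definition sumset U V : set A := [set x + y | x in U & y in V].

(* The image S V of V (x) S. *)
Definition scalar_image S V : set A :=
  [set x | exists m (a : 'I_m -> K) (v : 'I_m -> A),
    [/\ forall i, S (a i), forall i, V (v i) & x = \sum_i a i *: v i]].

Definition scaleset (a : K) U : set A := [set a *: x | x in U].

End Lie.

Definition reflections (F : fieldType) (W : finGroupType) (n : nat)
    (rV : mx_representation F [set: W]%SET n) : {set W} :=
  [set s : W | \rank (rV s - 1%:M) == 1%N]%SET.

Local Notation "x %:F" := (@FracField.tofrac _ x).

Section HeckeLie.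
Variables (k : fieldType) (W : finGroupType) (Refl : {set W}).

Definition lieH : set (group_algebra k W) :=
  lie_generated setT [set gelt k s | s in [set` Refl]].

Definition lieH_gr (r : nat) : set (group_algebra k W) :=
  lspan setT (iterated_bracket [set gelt k s | s in [set` Refl]] r).

Definition lieH_gr_even : set (group_algebra k W) :=
  \bigcup_(r in [set r | (1 <= r)%N]) lieH_gr (2 * r)%N.

(* Starts at degree 3: the reflections themselves are not included. *)
Definition lieH_gr_odd : set (group_algebra k W) :=
  \bigcup_(r in [set r | (1 <= r)%N]) lieH_gr (2 * r + 1)%N.

Definition ratfun := {fraction {poly k}}.

Definition hvar : ratfun := ('X)%:F.

(* k(h^2) as a subset of k(h). *)
Definition ratfun_h2 : set ratfun :=
  [set (p \Po 'X^2)%:F / (q \Po 'X^2)%:F | p in setT & q in [set q | q != 0]].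

(* The inclusion of k W into k(h) W. *)
Definition galg_ratfun (x : group_algebra k W) : group_algebra ratfun W :=
  [ffun g => ((x g)%:P)%:F].

Definition galg_h2 : set (group_algebra ratfun W) :=
  [set x : group_algebra ratfun W | forall g, ratfun_h2 (x g)].

Definition lieH_tail : set (group_algebra ratfun W) :=
  lie_generated ratfun_h2 [set hvar *: gelt ratfun s | s in [set` Refl]].

Definition lieH_tail0 := lieH_tail `&` galg_h2.

Definition lieH_tail1 := lieH_tail `&` scaleset hvar galg_h2.

End HeckeLie.

Arguments lieH k {W} Refl.
Arguments lieH_gr k {W} Refl r.
Arguments lieH_gr_even k {W} Refl.
Arguments lieH_gr_odd k {W} Refl.
Arguments ratfun_h2 k : clear implicits.
Arguments galg_ratfun k {W} x.
Arguments lieH_tail k {W} Refl.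
Arguments lieH_tail0 k {W} Refl.
Arguments lieH_tail1 k {W} Refl.

(* Main.v *)
(* An iterated bracket of r elements h s is h^r times the same bracket of the
   reflections, so everything reduces to comparing the span of the reflections
   with Z(H) modulo H_odd. If w is an involution, then
   [w, [w, s]] = 2 (s - w s w); as W is generated by such reflections, s differs
   from the average of its conjugates, which lies in Z(H), by an element of
   H_gr^3. Conversely, a central element of kW is a class function while the
   coefficients of a commutator sum to 0 over each conjugacy class; in
   characteristic 0 this gives Z(H) /\ [H, H] = 0, so Z(H) is spanned by these
   averages and meets H_odd trivially. *)

Require Import Defs.
From HB Require Import structures.
From mathcomp Require Import all_boot all_order all_algebra all_fingroup.
From mathcomp Require Import mxrepresentation.
From mathcomp Require Import boolp classical_sets reals.
From mathcomp Require Import complex.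

Set Implicit Arguments.
Unset Strict Implicit.
Unset Printing Implicit Defensive.

Import Order.TTheory GRing.Theory Num.Theory.
Local Open Scope ring_scope.
Local Open Scope classical_set_scope.

Local Notation "x %:F" := (@FracField.tofrac _ x).

(** * Brackets, spans and scalar images *)

Section LieLemmas.
Variables (K : comNzRingType) (A : algType K).
Implicit Types (S : set K) (U V X : set A) (x y z : A) (a : K).

Lemma bracketDl x y z : bracket (x + y) z = bracket x z + bracket y z.
Proof. by rewrite /bracket mulrDl mulrDr opprD addrACA. Qed.

Lemma bracketDr x y z : bracket z (x + y) = bracket z x + bracket z y.
Proof. by rewrite /bracket mulrDl mulrDr opprD addrACA. Qed.

Lemma bracketZl a x y : bracket (a *: x) y = a *: bracket x y.
Proof. by rewrite /bracket scalerBr -scalerAl -scalerAr. Qed.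

Lemma bracketZr a x y : bracket x (a *: y) = a *: bracket x y.
Proof. by rewrite /bracket scalerBr -scalerAl -scalerAr. Qed.

Lemma bracket0l x : bracket 0 x = 0.
Proof. by rewrite /bracket mul0r mulr0 subrr. Qed.

Lemma bracket0r x : bracket x 0 = 0.
Proof. by rewrite /bracket mul0r mulr0 subrr. Qed.

Lemma bracketC x y : bracket x y = - bracket y x.
Proof. by rewrite /bracket opprB. Qed.

Lemma bracketDD x x' y y' :
  bracket (x + x') (y + y') =
    (bracket x y + bracket x' y') + (bracket x y' - bracket y x').
Proof.
rewrite -(bracketC x' y) bracketDl !bracketDr.
by rewrite [bracket x' y + _]addrC addrACA.
Qed.

(** With its counterpart for the other argument, this lets a membership of brackets be checked on
    spanning elements, one argument at a time. *)
Lemma submodule_bracketl S U y :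
  is_submodule S U -> is_submodule S [set x | U (bracket x y)].
Proof.
case=> U0 UD UZ; split=> [|x z Ux Uz|a x Sa Ux] /=.
- by rewrite bracket0l.
- by rewrite bracketDl; apply: UD.
- by rewrite bracketZl; apply: UZ.
Qed.

Lemma submodule_bracketr S U x :
  is_submodule S U -> is_submodule S [set y | U (bracket x y)].
Proof.
case=> U0 UD UZ; split=> [|y z Uy Uz|a y Sa Uy] /=.
- by rewrite bracket0r.
- by rewrite bracketDr; apply: UD.
- by rewrite bracketZr; apply: UZ.
Qed.

Lemma submodule_sum S U (I : finType) (F : I -> A) :
  is_submodule S U -> (forall i, U (F i)) -> U (\sum_i F i).
Proof. by case=> U0 UD _ UF; elim/big_ind: _. Qed.

Lemma lspan_submodule S X : is_submodule S (lspan S X).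
Proof.
split=> [M [[]]//|x y Sx Sy M XM|a x Sa Sx M XM].
  by case: (XM) => -[_ MD _] _; apply: MD; [apply: Sx|apply: Sy].
by case: (XM) => -[_ _ MZ] _; apply: MZ => //; apply: Sx.
Qed.

Lemma lie_generated_subalgebra S X :
  is_lie_subalgebra S (lie_generated S X).
Proof.
split; first split.
- by move=> M [[[]]].
- move=> x y Sx Sy M XM; case: (XM) => -[[_ MD _] _] _.
  by apply: MD; [apply: Sx|apply: Sy].
- move=> a x Sa Sx M XM; case: (XM) => -[[_ _ MZ] _] _.
  by apply: MZ => //; apply: Sx.
- move=> x y Sx Sy M XM; case: (XM) => -[_ MB] _.
  by apply: MB; [apply: Sx|apply: Sy].
Qed.

(** Any parenthesization is allowed, so lengths add on the spanning elements; bilinearity does the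
    rest. *)
Lemma lspan_bracket S X p q x y :
    lspan S (iterated_bracket X p) x -> lspan S (iterated_bracket X q) y ->
  lspan S (iterated_bracket X (p + q)) (bracket x y).
Proof.
move=> px qy; pose L := lspan S (iterated_bracket X (p + q)).
have LS : is_submodule S L := lspan_submodule _ _.
suff: [set x | L (bracket x y)] x by [].
apply: (smallest_sub (submodule_bracketl y LS)) px => {}x px /=.
suff: [set y | L (bracket x y)] y by [].
apply: (smallest_sub (submodule_bracketr x LS)) qy => {}y qy /=.
by apply: sub_gen_smallest; apply: Iter_bracket.
Qed.

Lemma lspan_iterated_sub S X r :
  lspan S (iterated_bracket X r) `<=` lie_generated S X.
Proof.
have [GS GB] := lie_generated_subalgebra S X.
apply: (smallest_sub GS) => x; elim=> [y Xy|p q y z _ Gy _ Gz].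
  exact: sub_gen_smallest.
exact: GB.
Qed.

Lemma scalar_image_gen S V : S 1 -> V `<=` scalar_image S V.
Proof.
by move=> S1 v Vv; exists 1%N, (fun=> 1), (fun=> v); rewrite big_ord1 scale1r.
Qed.

Lemma scalar_image_sub S V U :
  is_submodule S U -> V `<=` U -> scalar_image S V `<=` U.
Proof.
move=> US VU _ [m [a [v [Sa Vv ->]]]]; apply: (submodule_sum US) => i.
by case: US => _ _ UZ; apply/UZ/VU.
Qed.

Lemma scalar_image_submodule S V :
  (forall a b, S a -> S b -> S (a * b)) -> is_submodule S (scalar_image S V).
Proof.
move=> SM; split.
- by exists 0%N, (fun=> 0), (fun=> 0); rewrite big_ord0; split=> // -[].
- move=> _ _ [m [a [v [Sa Vv ->]]]] [p [b [w [Sb Vw ->]]]].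
  exists (m + p)%N, (fun i => match split i with inl j => a j | inr j => b j end),
    (fun i => match split i with inl j => v j | inr j => w j end); split.
  + by move=> i; case: split.
  + by move=> i; case: split.
  rewrite big_split_ord; congr (_ + _); apply: eq_bigr => i _.
    by rewrite (unsplitK (inl i)).
  by rewrite (unsplitK (inr i)).
- move=> b _ Sb [m [a [v [Sa Vv ->]]]].
  exists m, (fun i => b * a i), v; split=> // [i|]; first exact: SM.
  by rewrite scaler_sumr; apply: eq_bigr => i _; rewrite scalerA.
Qed.

Lemma scaleset_submodule S a U :
  is_submodule S U -> is_submodule S (scaleset a U).
Proof.
case=> U0 UD UZ; split.
- by exists 0 => //; rewrite scaler0.
- by move=> _ _ [x Ux <-] [y Uy <-]; exists (x + y); [apply: UD|rewrite scalerDr].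
- move=> b _ Sb [x Ux <-]; exists (b *: x); first exact: UZ.
  by rewrite !scalerA mulrC.
Qed.

Lemma sumset_submodule S U V :
  is_submodule S U -> is_submodule S V -> is_submodule S (sumset U V).
Proof.
move=> [U0 UD UZ] [V0 VD VZ]; split.
- by exists 0 => //; exists 0 => //; rewrite addr0.
- move=> _ _ [u Uu [v Vv <-]] [u' Uu' [v' Vv' <-]].
  by exists (u + u'); [exact: UD|exists (v + v'); [exact: VD|rewrite addrACA]].
- move=> a _ Sa [u Uu [v Vv <-]].
  by exists (a *: u); [exact: UZ|exists (a *: v); [exact: VZ|rewrite scalerDr]].
Qed.

Lemma scalar_image_bracket S U V X :
    is_submodule S X ->
    (forall u v, U u -> V v -> X (bracket u v)) ->
  forall u v, scalar_image S U u -> scalar_image S V v -> X (bracket u v).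
Proof.
move=> XS UV u v Su Sv.
apply: (scalar_image_sub (submodule_bracketl v XS)) Su => {}u Uu /=.
by apply: (scalar_image_sub (submodule_bracketr u XS)) Sv => {}v Vv /=; apply: UV.
Qed.

End LieLemmas.

(** * Conjugation and traces on the group algebra *)

Section GroupAlgebraLemmas.
Variables (K : comNzRingType) (W : finGroupType).
Implicit Types (g h w : W) (x y z : group_algebra K W).

Lemma gelt_mulE g x h : (gelt K g * x) h = x (g^-1 * h)%g.
Proof.
rewrite ffunE (bigD1 g) //= ffunE eqxx mul1r big1 ?addr0 // => u ug.
by rewrite ffunE (negPf ug) mul0r.
Qed.

Lemma mul_geltE g x h : (x * gelt K g) h = x (h * g^-1)%g.
Proof.
rewrite ffunE (bigD1 (h * g^-1)%g) //= ffunE invMg invgK mulgKV eqxx mulr1.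
rewrite big1 ?addr0 // => u uh; rewrite ffunE.
rewrite -(inj_eq (mulgI u)) mulKVg -(inj_eq (mulIg g^-1%g)) mulgK eq_sym.
by rewrite (negPf uh) mulr0.
Qed.

Lemma geltM g h : gelt K g * gelt K h = gelt K (g * h)%g.
Proof.
apply/ffunP=> u; rewrite gelt_mulE !ffunE.
by rewrite -(inj_eq (mulgI g)) mulKVg.
Qed.

Lemma bracket_gelt_eq0 g z :
  (bracket z (gelt K g) = 0) <-> (forall h, z (g * h * g^-1)%g = z h).
Proof.
split=> [/eqP|zg].
  rewrite subr_eq0 => /eqP /ffunP zg h.
  by have := zg (g * h)%g; rewrite mul_geltE gelt_mulE mulKg.
apply/eqP; rewrite subr_eq0; apply/eqP/ffunP=> h.
by rewrite mul_geltE gelt_mulE -[RHS]zg mulKVg.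
Qed.

(** Class functions, that is, the central elements of the group algebra. *)
Definition conj_invariant x := forall g h, x (g * h * g^-1)%g = x h.

Lemma conj_invariant_comm x y : conj_invariant x -> bracket x y = 0.
Proof.
move=> xg; apply/eqP; rewrite subr_eq0; apply/eqP/ffunP=> h; rewrite !ffunE.
(* The substitution of [h * u^-1] for [u] exchanges the two factors of the convolution. *)
rewrite (reindex_inj (inj_comp (mulgI h) invg_inj)) /=; apply: eq_bigr => u _.
rewrite invMg invgK mulgKV mulrC; congr (_ * _).
by rewrite -[LHS](xg u^-1%g) invgK mulgA mulgKV.
Qed.

(* The class sums of the coefficients, up to the factor [#|'C[g]|]. *)
Definition class_sum g x : K := \sum_(u : W) x (u * g * u^-1)%g.

(** Both sides run over pairs of group elements whose product is conjugate to [g], and [u * v] is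
    conjugate to [v * u]. *)
Lemma class_sum_mulC g x y : class_sum g (x * y) = class_sum g (y * x).
Proof.
rewrite /class_sum.
under eq_bigr => u _ do rewrite ffunE.
under [RHS]eq_bigr => u _ do rewrite ffunE.
rewrite exchange_big /=.
rewrite [RHS](eq_bigr (fun u => \sum_v
    x v * y (u * g * u^-1 * v^-1)%g)); last first.
  move=> u _; rewrite (reindex_inj (inj_comp (mulgI (u * g * u^-1)%g) invg_inj)).
  by apply: eq_bigr => v _; rewrite /= invMg invgK mulgKV mulrC.
rewrite [RHS]exchange_big /=; apply: eq_bigr => v _.
rewrite (reindex_inj (mulgI v)) /=; apply: eq_bigr => u _.
by rewrite invMg !mulgA mulVg mul1g.
Qed.

Lemma class_sum_bracket g x y : class_sum g (bracket x y) = 0.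
Proof.
have -> : class_sum g (bracket x y) = class_sum g (x * y) - class_sum g (y * x).
  by rewrite /class_sum -sumrB; apply: eq_bigr => u _; rewrite !ffunE.
by rewrite class_sum_mulC subrr.
Qed.

Lemma class_sum0_submodule :
  is_submodule setT [set x | forall g, class_sum g x = 0].
Proof.
split=> [g|x y x0 y0 g|a x _ x0 g].
- by rewrite /class_sum big1 // => u _; rewrite ffunE.
- rewrite -[RHS]addr0 -{1}(x0 g) -(y0 g) /class_sum -big_split /=.
  by apply: eq_bigr => u _; rewrite ffunE.
- rewrite -[RHS](mulr0 a) -(x0 g) /class_sum mulr_sumr.
  by apply: eq_bigr => u _; rewrite ffunE.
Qed.

End GroupAlgebraLemmas.

(** * The center of [lieH] and the odd part *)

Section Center.
Variables (k : fieldType) (W : finGroupType) (Refl : {set W}).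
Hypothesis k_char0 : [pchar k] =i pred0.
Hypothesis Refl_conj : forall g s, s \in Refl -> (g * s * g^-1)%g \in Refl.
Hypothesis Refl_gen :
  <<[set s in Refl | #[s]%g == 2%N]%SET>>%g = [set: W]%SET.
Implicit Types (g s : W) (x y z : group_algebra k W).

Lemma cardW_neq0 : (#|W|%:R : k) != 0.
Proof.
by have /pcharf0P -> := k_char0; rewrite -lt0n; apply/card_gt0P; exists 1%g.
Qed.

(** On a class function the class sum at [g] is [#|W|] times the value at [g], and [#|W|] is
    invertible in characteristic 0. *)
Lemma class_sum0_conj_invariant x :
  conj_invariant x -> (forall g, class_sum g x = 0) -> x = 0.
Proof.
move=> xg x0; apply/ffunP=> g; rewrite ffunE; apply/eqP.
have := x0 g; rewrite /class_sum (eq_bigr (fun=> x g)) // sumr_const.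
by move/eqP; rewrite -mulr_natl mulf_eq0 (negPf cardW_neq0).
Qed.

Let reflX : set (group_algebra k W) := [set gelt k s | s in [set` Refl]].

Lemma lieH_gr_bracket p q x y : lieH_gr k Refl p x -> lieH_gr k Refl q y ->
  lieH_gr k Refl (p + q) (bracket x y).
Proof. exact: lspan_bracket. Qed.

Lemma lieH_gr_submodule r : is_submodule setT (lieH_gr k Refl r).
Proof. exact: lspan_submodule. Qed.

(** Commuting with a reflection means invariance under conjugation by it; invariance passes to
    products, hence to all of [W]. *)
Lemma lieH_center_conj_invariant z :
  lie_center (lieH k Refl) z -> conj_invariant z.
Proof.
case=> _ zH g.
have: g \in [set: W]%SET by rewrite inE.
rewrite -Refl_gen => /gen_prodgP[n [c cR ->]].
elim/big_ind: _ => [h|g1 g2 zg1 zg2 h|i _ h].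
- by rewrite invg1 mul1g mulg1.
- by rewrite invMg !mulgA -(mulgA g1) -(mulgA g1) zg1 zg2.
have := cR i; rewrite inE => /andP[ci _].
suff /bracket_gelt_eq0 : bracket z (gelt k (c i)) = 0 by apply.
by apply: zH; apply: sub_gen_smallest; exists (c i).
Qed.

(** Each conjugate occurs as often as the centralizer of [s] has elements; division by [#|W|] gives
    the average of the conjugates. *)
Definition conj_sum s : group_algebra k W :=
  \sum_(g : W) gelt k (g * s * g^-1)%g.

Lemma conj_sum_invariant s : conj_invariant (conj_sum s).
Proof.
move=> g h; rewrite /conj_sum !sum_ffunE [LHS](reindex_inj (mulgI g)).
apply: eq_bigr => u _; rewrite !ffunE /= invMg !mulgA.
by rewrite (inj_eq (mulIg _)) -!mulgA (inj_eq (mulgI _)).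
Qed.

Lemma lieH_submodule : is_submodule setT (lieH k Refl).
Proof. by case: (lie_generated_subalgebra setT reflX). Qed.

Lemma conj_sum_center s : s \in Refl -> lie_center (lieH k Refl) (conj_sum s).
Proof.
move=> sR; split=> [|x _]; last exact: conj_invariant_comm (conj_sum_invariant s).
apply: (submodule_sum lieH_submodule) => g; apply: sub_gen_smallest.
by exists (g * s * g^-1)%g => //; apply: Refl_conj.
Qed.

Lemma sub_conj_gr3 g s :
  s \in Refl -> lieH_gr k Refl 3 (gelt k s - gelt k (g * s * g^-1)%g).
Proof.
have [gr0 grD grZ] := lieH_gr_submodule 3.
have: g \in [set: W]%SET by rewrite inE.
rewrite -Refl_gen => /gen_prodgP[n [c cR ->]] {g}.
(* Induction on a word for [g] in involutions, for all [s] at once: the hypothesis on [g1] is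
   applied to the conjugate of [s] by [g2], and the two differences telescope. *)
elim/big_ind: _ s => [s sR|g1 g2 IH1 IH2 s sR|i _ s sR].
- by rewrite invg1 mul1g mulg1 subrr.
- have := grD _ _ (IH2 s sR) (IH1 _ (Refl_conj g2 sR)).
  by rewrite invMg !mulgA addrA subrK.
have := cR i; rewrite inE => /andP[wR /eqP w2]; set w := c i in wR w2 *.
have ww : (w * w = 1)%g by rewrite -[RHS](expg_order w) w2.
have wV : (w^-1 = w)%g by apply: (mulgI w); rewrite mulgV.
have two0 : (2%:R : k) != 0 by have /pcharf0P -> := k_char0.
(* [ad w]^2 s = 2 (s - w s w) because w^2 = 1. *)
have -> : gelt k s - gelt k (w * s * w^-1)%g =
    2%:R^-1 *: bracket (gelt k w) (bracket (gelt k w) (gelt k s)).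
  rewrite /bracket mulrBr mulrBl !geltM !mulgA ww mul1g -(mulgA s) ww mulg1 wV.
  by rewrite opprB -mulr2n -scaler_nat scalerA mulVf ?scale1r.
have gen1 t : t \in Refl -> lieH_gr k Refl 1 (gelt k t).
  by move=> tR; apply: sub_gen_smallest; apply: Iter_elt; exists t.
apply: grZ => //; apply: (@lieH_gr_bracket 1 2); first exact: gen1.
by apply: (@lieH_gr_bracket 1 1); apply: gen1.
Qed.

(** The average of the conjugates plus the average of the differences from them: for a reflection
    [s], the first is central and the second lies in degree 3. *)
Lemma gelt_conj_sum s :
  gelt k s = #|W|%:R^-1 *: conj_sum s
           + #|W|%:R^-1 *: \sum_(g : W) (gelt k s - gelt k (g * s * g^-1)%g).
Proof.
rewrite -scalerDr -big_split /= (eq_bigr (fun=> gelt k s)) => [|g _].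
  by rewrite sumr_const -scaler_nat scalerA mulVf ?scale1r ?cardW_neq0.
by rewrite addrC subrK.
Qed.

Lemma gelt_center_odd s : s \in Refl ->
  sumset (lie_center (lieH k Refl)) (lieH_gr_odd k Refl) (gelt k s).
Proof.
move=> sR; rewrite gelt_conj_sum.
have [cH cC] := conj_sum_center sR.
exists (#|W|%:R^-1 *: conj_sum s).
  split=> [|x /cC xs]; first by have [_ _ HZ] := lieH_submodule; apply: HZ.
  by rewrite bracketZl xs scaler0.
exists (#|W|%:R^-1 *: \sum_(g : W) (gelt k s - gelt k (g * s * g^-1)%g)) => //.
(* Index 1 of the odd union is degree 3. *)
exists 1%N => //; have [_ _ grZ] := lieH_gr_submodule 3; apply: grZ => //.
by apply: (submodule_sum (lieH_gr_submodule 3)) => g; apply: sub_conj_gr3.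
Qed.

(** A difference of conjugates is the commutator of [g^-1] and [g * s], taken in the full group
    algebra. *)
Lemma class_sum_sub_conj g s u :
  class_sum u (gelt k s - gelt k (g * s * g^-1)%g) = 0.
Proof.
have -> : gelt k s - gelt k (g * s * g^-1)%g =
    bracket (gelt k g^-1%g) (gelt k (g * s)%g).
  by rewrite /bracket !geltM mulKg.
exact: class_sum_bracket.
Qed.

(** Modulo the kernel [T] of the class sums, every element of [lieH] is a class function in [L]. A
    central element is itself a class function, so its component in [T] is one too and vanishes. *)
Lemma lie_center_sub (L : set (group_algebra k W)) :
    is_submodule setT L -> (forall s, s \in Refl -> L (gelt k s)) ->
  lie_center (lieH k Refl) `<=` L.
Proof.
move=> Lsub LR z zC.
pose C : set (group_algebra k W) :=
  [set c | L c /\ conj_invariant c].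
pose T : set (group_algebra k W) := [set y | forall g, class_sum g y = 0].
have Tsub : is_submodule setT T := class_sum0_submodule k W.
have Csub : is_submodule setT C.
  have [L0 LD LZ] := Lsub.
  split=> [|x y [Lx xg] [Ly yg]|a x _ [Lx xg]].
  - by split=> // g h; rewrite !ffunE.
  - by split=> [|g h]; [exact: LD|rewrite !ffunE xg yg].
  - by split=> [|g h]; [exact: LZ|rewrite !ffunE xg].
(* Brackets already lie in [T]; the reflections are decomposed by averaging over their
   conjugates. *)
have HCT : lieH k Refl `<=` sumset C T.
  apply: smallest_sub => [|_ [s sR <-]].
    split; first exact: sumset_submodule.
    move=> x y _ _; exists 0; first by case: Csub.
    by exists (bracket x y) => [g|]; [exact: class_sum_bracket|rewrite add0r].
  rewrite gelt_conj_sum.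
  exists (#|W|%:R^-1 *: conj_sum s).
    have [_ _ CZ] := Csub; apply: CZ => //; split; last exact: conj_sum_invariant.
    by apply: (submodule_sum Lsub) => g; apply/LR/Refl_conj.
  exists (#|W|%:R^-1 *: \sum_(g : W) (gelt k s - gelt k (g * s * g^-1)%g)) => //.
  have [_ _ TZ] := Tsub; apply: TZ => //.
  by apply: (submodule_sum Tsub) => g u; apply: class_sum_sub_conj.
have [c [Lc cg] [y y0 zE]] := HCT z (proj1 zC).
suff y_eq0 : y = 0 by rewrite -zE y_eq0 addr0.
apply: class_sum0_conj_invariant y0 => g h.
have -> : y = z - c by rewrite -zE addrC addKr.
by rewrite !ffunE cg (lieH_center_conj_invariant zC).
Qed.

(** From length 2 on, every spanning element is a commutator. *)
Lemma lieH_gr_class_sum r x :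
  (1 < r)%N -> lieH_gr k Refl r x -> forall g, class_sum g x = 0.
Proof.
move=> r1; apply: (smallest_sub (class_sum0_submodule k W)) => y ry.
case: ry r1 => // p q u v _ _ _ g; exact: class_sum_bracket.
Qed.

(** A common element is a class function with vanishing class sums. The odd union starts at degree
    3, which excludes the reflections themselves. *)
Lemma lie_center_odd0 :
  lie_center (lieH k Refl) `&` lieH_gr_odd k Refl = [set 0].
Proof.
apply/seteqP; split=> [x [xC [r /= r1 xr]]|_ ->] /=.
  apply: class_sum0_conj_invariant (lieH_center_conj_invariant xC) _.
  by apply: lieH_gr_class_sum xr; rewrite addn1 ltnS muln_gt0.
split; first by split=> [|x _]; [case: lieH_submodule|exact: bracket0l].
by exists 1%N => //; case: (lieH_gr_submodule (2 * 1 + 1)).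
Qed.

End Center.

(** * Parity of rational functions in [h] *)

Section RationalFunctions.
Variable k : fieldType.
Implicit Types f g : ratfun k.
Local Notation S := (ratfun_h2 k).
Local Notation h := (hvar k).

Lemma comp_X2_eq0 (p : {poly k}) : (p \Po 'X^2 == 0) = (p == 0).
Proof. by apply: comp_poly_eq0; rewrite size_polyXn. Qed.

Lemma hvar_neq0 : h != 0.
Proof. by rewrite tofrac_eq0 polyX_eq0. Qed.

Lemma ratfun_h2_poly (p : {poly k}) : S (p \Po 'X^2)%:F.
Proof.
exists p => //; exists 1; first exact: oner_neq0.
by rewrite comp_polyC tofrac1 divr1.
Qed.

Lemma ratfun_h2C (c : k) : S (c%:P)%:F.
Proof. by have := ratfun_h2_poly c%:P; rewrite comp_polyC. Qed.

Lemma ratfun_h2_1 : S 1.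
Proof. by have := ratfun_h2C 1; rewrite tofrac1. Qed.

Lemma ratfun_h2D f g : S f -> S g -> S (f + g).
Proof.
move=> [p _ [q /= q0 <-]] [p' _ [q' /= q'0 <-]].
exists (p * q' + p' * q) => //; exists (q * q'); first exact: mulf_neq0.
rewrite addf_div ?tofrac_eq0 ?comp_X2_eq0 //.
by rewrite comp_polyD !comp_polyM tofracD !tofracM.
Qed.

Lemma ratfun_h2M f g : S f -> S g -> S (f * g).
Proof.
move=> [p _ [q /= q0 <-]] [p' _ [q' /= q'0 <-]].
exists (p * p') => //; exists (q * q'); first exact: mulf_neq0.
by rewrite mulf_div !comp_polyM !tofracM.
Qed.

(** This scalar removes the even power of [h] that accumulates in an iterated bracket. *)
Lemma ratfun_h2_expV r : S (h ^+ (2 * r))^-1.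
Proof.
exists 1 => //; exists ('X^r); first by rewrite /= -size_poly_eq0 size_polyXn.
by rewrite comp_polyC tofrac1 div1r comp_Xn_poly -exprM rmorphXn.
Qed.

Lemma ratfun_h2_hvar2 : S (h ^+ 2).
Proof. by have := ratfun_h2_poly 'X; rewrite comp_polyX rmorphXn. Qed.

(* h is not in k(h^2), by parity of exponents *)
Lemma ratfun_h2_hvar_eq0 f : S f -> S (h * f) -> f = 0.
Proof.
move=> [p _ [q /= q0 <-]] [p' _ [q' /= q'0]].
have q0' : (q \Po 'X^2)%:F != 0 :> ratfun k by rewrite tofrac_eq0 comp_X2_eq0.
have q'0' : (q' \Po 'X^2)%:F != 0 :> ratfun k by rewrite tofrac_eq0 comp_X2_eq0.
rewrite mulrA => /eqP; rewrite (eqr_div _ _ q'0' q0') /hvar -3!tofracM tofrac_eq -mulrA.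
rewrite -2!comp_polyM => /eqP pq.
suff -> : p = 0 by rewrite comp_poly0 tofrac0 mul0r.
suff : p * q' == 0 by rewrite mulf_eq0 (negPf q'0) orbF => /eqP.
apply/eqP/polyP=> i; rewrite coef0.
(* In degree [2 * i + 1], the side with the factor ['X] has the [i]-th coefficient of [p * q'],
   while the other side has only even exponents. *)
have /polyP/(_ (2 * i).+1) := pq.
rewrite coefXM /= !coef_comp_poly_Xn // dvdn_mulr // mulKn // => <-.
by rewrite dvdn2 /= mul2n odd_double.
Qed.

End RationalFunctions.

(** * Embedding [kW] into [k(h)W] *)

Section Tail.
Variables (k : fieldType) (W : finGroupType) (Refl : {set W}).
Implicit Types (x y : group_algebra k W).
Local Notation S := (ratfun_h2 k).
Local Notation h := (hvar k).
Local Notation iota := (@galg_ratfun k W).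

Lemma galg_ratfunD x y : iota (x + y) = iota x + iota y.
Proof. by apply/ffunP=> g; rewrite !ffunE !rmorphD. Qed.

Lemma galg_ratfunZ a x : iota (a *: x) = (a%:P)%:F *: iota x.
Proof. by apply/ffunP=> g; rewrite !ffunE -[RHS]/(_ * _) -tofracM -polyCM. Qed.

Lemma galg_ratfun_gelt g : iota (gelt k g) = gelt (ratfun k) g.
Proof. by apply/ffunP=> u; rewrite !ffunE; case: eqP; rewrite ?tofrac1 ?tofrac0. Qed.

Lemma galg_ratfun_bracket x y : iota (bracket x y) = bracket (iota x) (iota y).
Proof.
apply/ffunP=> g; rewrite !ffunE !rmorphB /= !rmorph_sum.
by congr (_ - _); apply: eq_bigr => u _; rewrite !ffunE !rmorphM.
Qed.

Lemma galg_ratfun0 : iota 0 = 0.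
Proof. by rewrite -(scale0r 0) galg_ratfunZ tofrac0 scale0r. Qed.

(** Constants lie in [k(h^2)], so [k(h^2)]-submodules pull back to [k]-subspaces; claims about the
    tail algebra can thus be checked on spanning elements inside [kW]. *)
Lemma galg_ratfun_submodule c (U : set (group_algebra (ratfun k) W)) :
  is_submodule S U -> is_submodule setT [set x | U (c *: iota x)].
Proof.
case=> U0 UD UZ; split=> [|x y Ux Uy|a x _ Ux] /=.
- by rewrite galg_ratfun0 scaler0.
- by rewrite galg_ratfunD scalerDr; apply: UD.
- rewrite galg_ratfunZ scalerA mulrC -scalerA; apply: UZ => //.
  exact: ratfun_h2C.
Qed.

Lemma galg_h2_submodule : is_submodule S (@galg_h2 k W).
Proof.
split=> [g|x y Sx Sy g|a x Sa Sx g]; rewrite !ffunE.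
- by have := ratfun_h2C (0 : k); rewrite tofrac0.
- exact: ratfun_h2D.
- exact: ratfun_h2M.
Qed.

Lemma galg_ratfun_h2 x : galg_h2 (iota x).
Proof. by move=> g; rewrite ffunE; apply: ratfun_h2C. Qed.

Lemma galg_h2_odd_eq0 (z : group_algebra (ratfun k) W) :
  galg_h2 z -> galg_h2 (h *: z) -> z = 0.
Proof.
move=> Sz Shz; apply/ffunP=> g; rewrite ffunE.
by apply: ratfun_h2_hvar_eq0 => //; have := Shz g; rewrite ffunE.
Qed.

Lemma lieH_tail_submodule : is_submodule S (lieH_tail k Refl).
Proof.
by case: (lie_generated_subalgebra S [set h *: gelt (ratfun k) s | s in [set` Refl]]).
Qed.

(** Each reflection carries one factor [h], so the exponent is the length of the bracket. *)
Lemma lieH_tail_gr r x :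
  lieH_gr k Refl r x -> lieH_tail k Refl (h ^+ r *: iota x).
Proof.
have [_ TB] :=
  lie_generated_subalgebra S [set h *: gelt (ratfun k) s | s in [set` Refl]].
apply: (smallest_sub (galg_ratfun_submodule _ lieH_tail_submodule)) => {}x.
elim=> [_ [s sR <-]|p q y z _ Ty _ Tz] /=.
  by rewrite expr1 galg_ratfun_gelt; apply: sub_gen_smallest; exists s.
have := TB _ _ Ty Tz.
by rewrite bracketZl bracketZr scalerA -exprD galg_ratfun_bracket.
Qed.

End Tail.

(** * Even and odd components of the tail algebra *)

Section TailComponents.
Variables (k : fieldType) (W : finGroupType) (Refl : {set W}).
Hypothesis k_char0 : [pchar k] =i pred0.
Hypothesis Refl_conj : forall g s, s \in Refl -> (g * s * g^-1)%g \in Refl.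
Hypothesis Refl_gen :
  <<[set s in Refl | #[s]%g == 2%N]%SET>>%g = [set: W]%SET.
Local Notation S := (ratfun_h2 k).
Local Notation h := (hvar k).
Local Notation iota := (@galg_ratfun k W).
Local Notation Z := (lie_center (lieH k Refl)).
Local Notation H0 := (lieH_gr_even k Refl).
Local Notation H1 := (lieH_gr_odd k Refl).
Local Notation E0 := (scalar_image S (iota @` H0)).
Local Notation E1 := (scaleset h (scalar_image S (iota @` sumset Z H1))).

Lemma even_sub_lieH : H0 `<=` lieH k Refl.
Proof. by move=> x [r _ xr]; apply: lspan_iterated_sub xr. Qed.

Lemma odd_sub_lieH : H1 `<=` lieH k Refl.
Proof. by move=> x [r _ xr]; apply: lspan_iterated_sub xr. Qed.

Lemma lie_center0 : Z 0.
Proof. by split=> [|x _]; [case: (lieH_submodule k Refl)|exact: bracket0l]. Qed.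

Lemma even_bracket x y : H0 x -> H0 y -> H0 (bracket x y).
Proof.
move=> [r /= r0 xr] [q _ yq]; exists (r + q)%N; first by rewrite /= addn_gt0 r0.
by rewrite mulnDr; apply: lieH_gr_bracket.
Qed.

Lemma even_odd_bracket x y : H0 x -> H1 y -> H1 (bracket x y).
Proof.
move=> [r /= r0 xr] [q _ yq]; exists (r + q)%N; first by rewrite /= addn_gt0 r0.
by rewrite mulnDr -addnA; apply: lieH_gr_bracket.
Qed.

Lemma odd_bracket x y : H1 x -> H1 y -> H0 (bracket x y).
Proof.
move=> [r _ xr] [q _ yq]; exists (r + q).+1 => //=.
have -> : (2 * (r + q).+1 = (2 * r + 1) + (2 * q + 1))%N.
  by rewrite mulnS mulnDr addnC [RHS]addnACA.
exact: lieH_gr_bracket.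
Qed.

Lemma even_center_odd_bracket x y :
  H0 x -> sumset Z H1 y -> sumset Z H1 (bracket x y).
Proof.
move=> x0 [z [_ zC] [b b1 <-]]; exists 0; first exact: lie_center0.
exists (bracket x b); first exact: even_odd_bracket.
by rewrite bracketDr [bracket x z]bracketC (zC x (even_sub_lieH x0)) oppr0.
Qed.

(** The central parts drop out, leaving the bracket of two odd elements. *)
Lemma center_odd_bracket x y :
  sumset Z H1 x -> sumset Z H1 y -> H0 (bracket x y).
Proof.
move=> [z [_ zC] [b b1 <-]] [z' [zH' zC'] [b' b1' <-]].
rewrite !(bracketDl, bracketDr) (zC z') // (zC b') ?add0r; last exact: odd_sub_lieH.
rewrite [X in X + _]bracketC zC' ?oppr0 ?add0r; last exact: odd_sub_lieH.
exact: odd_bracket.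
Qed.

Let SM : forall a b, S a -> S b -> S (a * b) := @ratfun_h2M k.
Let E0sub : is_submodule S E0 := scalar_image_submodule _ SM.
Let E1sub : is_submodule S E1 :=
  scaleset_submodule h (scalar_image_submodule _ SM).

(** The right-hand side is a Lie subalgebra because brackets respect parity, and it contains the
    generators because a reflection splits into a central and an odd part. *)
Lemma lieH_tail_sub : lieH_tail k Refl `<=` sumset E0 E1.
Proof.
have S1 := ratfun_h2_1 k.
have [E00 E0D E0Z] := E0sub; have [E10 E1D E1Z] := E1sub.
apply: smallest_sub => [|_ [s sR <-]]; last first.
  exists 0 => //; exists (h *: gelt (ratfun k) s); last by rewrite add0r.
  exists (gelt (ratfun k) s) => //; apply: scalar_image_gen => //.
  by exists (gelt k s); [exact: gelt_center_odd|exact: galg_ratfun_gelt].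
split; first exact: sumset_submodule.
have B01 x y : E0 x -> E1 y -> E1 (bracket x y).
  move=> x0 [y' y1 <-]; rewrite bracketZr; exists (bracket x y') => //.
  apply: scalar_image_bracket x0 y1; first exact: scalar_image_submodule.
  move=> _ _ [u u0 <-] [v v1 <-]; apply: scalar_image_gen => //.
  exists (bracket u v); last exact: galg_ratfun_bracket.
  exact: even_center_odd_bracket.
move=> _ _ [x0 Ex0 [x1 Ex1 <-]] [y0 Ey0 [y1 Ey1 <-]].
exists (bracket x0 y0 + bracket x1 y1).
  apply: E0D.
    apply: scalar_image_bracket Ex0 Ey0 => //.
    move=> _ _ [u u0 <-] [v v0 <-]; apply: scalar_image_gen => //.
    exists (bracket u v); [exact: even_bracket|exact: galg_ratfun_bracket].
  case: Ex1 => x Ex <-; case: Ey1 => y Ey <-.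
  (* The two factors [h] combine into [h^2], a scalar of [k(h^2)]. *)
  rewrite bracketZl bracketZr scalerA; apply: E0Z; first exact: ratfun_h2_hvar2.
  apply: scalar_image_bracket Ex Ey => //.
  move=> _ _ [u u0 <-] [v v0 <-]; apply: scalar_image_gen => //.
  exists (bracket u v); [exact: center_odd_bracket|exact: galg_ratfun_bracket].
exists (bracket x0 y1 - bracket y0 x1).
  apply: E1D; first exact: B01.
  rewrite -scaleN1r; apply: E1Z; last exact: B01.
  by have := ratfun_h2C (-1 : k); rewrite !rmorphN /= tofrac1.
by rewrite bracketDD.
Qed.

Lemma even_sub_lieH_tail : E0 `<=` lieH_tail k Refl.
Proof.
have [_ _ TZ] := lieH_tail_submodule k Refl.
apply: (scalar_image_sub (lieH_tail_submodule k Refl)) => _ [x [r _ xr] <-].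
have hr : h ^+ (2 * r) != 0 by rewrite expf_neq0 ?hvar_neq0.
rewrite -[iota x]scale1r -(mulVf hr) -scalerA; apply: TZ.
  exact: ratfun_h2_expV.
exact: lieH_tail_gr.
Qed.

Lemma odd_sub_lieH_tail : E1 `<=` lieH_tail k Refl.
Proof.
have [T0 TD TZ] := lieH_tail_submodule k Refl.
have Tsub := galg_ratfun_submodule h (lieH_tail_submodule k Refl).
move=> _ [y Ey <-]; suff: [set y | lieH_tail k Refl (h *: y)] y by [].
apply: (scalar_image_sub _ _ Ey).
  split=> [|u v Tu Tv|a u Sa Tu] /=; first by rewrite scaler0.
    by rewrite scalerDr; apply: TD.
  by rewrite scalerA mulrC -scalerA; apply: TZ.
move=> _ [_ [z zC [b [r _ br] <-]] <-].
rewrite /= galg_ratfunD scalerDr; apply: TD.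
  (* The elements of [kW] that [h] carries into the tail algebra form a subspace containing the
     reflections, hence the center of [lieH]. *)
  apply: (lie_center_sub k_char0 Refl_conj Refl_gen Tsub) zC => s sR.
  by rewrite /= galg_ratfun_gelt; apply: sub_gen_smallest; exists s.
have hr : h ^+ (2 * r) != 0 by rewrite expf_neq0 ?hvar_neq0.
(* The factor [h] is rewritten as [h^(2r+1)] times the scalar [h^(-2r)], matching the length [2r+1]
   of the brackets in [b]. *)
rewrite -[iota b]scale1r -(mulVf hr) scalerA mulrCA -exprS -[(2 * r).+1]addn1 -scalerA.
apply: TZ; first exact: ratfun_h2_expV.
exact: lieH_tail_gr.
Qed.

Lemma even_sub_galg_h2 : E0 `<=` @galg_h2 k W.
Proof.
apply: (scalar_image_sub (galg_h2_submodule k W)) => _ [x _ <-].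
exact: galg_ratfun_h2.
Qed.

Lemma center_odd_sub_galg_h2 :
  scalar_image S (iota @` sumset Z H1) `<=` @galg_h2 k W.
Proof.
apply: (scalar_image_sub (galg_h2_submodule k W)) => _ [x _ <-].
exact: galg_ratfun_h2.
Qed.

Lemma lieH_tail0E : lieH_tail0 k Refl = E0.
Proof.
have [_ GD GZ] := galg_h2_submodule k W.
apply/seteqP; split=> [x [/lieH_tail_sub[x0 Ex0 [_ [y Ey <-] <-]] xG]|x Ex].
  have yG := center_odd_sub_galg_h2 Ey.
  (* Both [x] and [x0] have coefficients in [k(h^2)], so [h *: y] does as well, and [y] vanishes by
     parity. *)
  rewrite (galg_h2_odd_eq0 yG) ?scaler0 ?addr0 //.
  have -> : h *: y = (x0 + h *: y) - x0 by rewrite addrC addKr.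
  rewrite -[- x0]scaleN1r; apply: GD => //; apply: GZ.
    by have := ratfun_h2C (-1 : k); rewrite !rmorphN /= tofrac1.
  exact: even_sub_galg_h2.
by split; [exact: even_sub_lieH_tail|exact: even_sub_galg_h2].
Qed.

Lemma lieH_tail1E : lieH_tail1 k Refl = E1.
Proof.
have [_ GD GZ] := galg_h2_submodule k W.
have SN1 : S (-1) by have := ratfun_h2C (-1 : k); rewrite !rmorphN /= tofrac1.
apply/seteqP; split=> [x [/lieH_tail_sub[x0 Ex0 [_ [y Ey <-] <-]] [w wG wE]]|x Ex].
  have yG := center_odd_sub_galg_h2 Ey.
  suff x00 : x0 = 0 by rewrite x00 add0r; exists y.
  (* The even element [x0] is also [h] times an element over [k(h^2)], hence zero by parity. *)
  have x0E : h *: (w - y) = x0 by rewrite scalerBr wE addrK.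
  have wyG : galg_h2 (w - y) by rewrite -[- y]scaleN1r; apply/GD/GZ.
  rewrite -x0E (galg_h2_odd_eq0 wyG) ?scaler0 // x0E.
  exact: even_sub_galg_h2.
split; first exact: odd_sub_lieH_tail.
by case: Ex => y /center_odd_sub_galg_h2 yG <-; exists y.
Qed.

End TailComponents.

(** * Complex reflections and the main result *)

Lemma reflections_conj (F : fieldType) (W : finGroupType) (n : nat)
    (rV : mx_representation F [set: W]%SET n) (g s : W) :
  s \in reflections rV -> (g * s * g^-1)%g \in reflections rV.
Proof.
rewrite !inE => /eqP rs.
have rU u : rV u \in unitmx by apply: repr_mx_unit; rewrite inE.
(* Subtracting the identity commutes with conjugation by the invertible [rV g], which preserves the
   rank. *)
have -> : rV (g * s * g^-1)%g - 1%:M = rV g *m (rV s - 1%:M) *m rV g^-1%g.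
  rewrite mulmxBr mulmxBl mulmx1 -!repr_mxM ?inE //.
  by rewrite mulgV repr_mx1.
by rewrite mxrankMfree ?row_free_unit // eqmxMfull ?row_full_unit // rs.
Qed.

(** The middle clause expresses that the sum of the center and the odd part is direct. *)
Theorem proposition1p4 (R : realType) (W : finGroupType) (n : nat)
    (rV : mx_representation R[i] [set: W]%SET n)
    (rV_faithful : mx_faithful rV)
    (W_generated :
       <<[set s in reflections rV | #[s]%g == 2%N]%SET>>%g = [set: W]%SET)
    (k : fieldType) (k_char0 : [pchar k] =i pred0) :
  lieH_tail0 k (reflections rV) =
    scalar_image (ratfun_h2 k)
      (galg_ratfun k @` lieH_gr_even k (reflections rV)) /\
  lie_center (lieH k (reflections rV)) `&` lieH_gr_odd k (reflections rV)
    = [set 0] /\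
  lieH_tail1 k (reflections rV) =
    scaleset (hvar k) (scalar_image (ratfun_h2 k)
      (galg_ratfun k @`
         sumset (lie_center (lieH k (reflections rV)))
                (lieH_gr_odd k (reflections rV)))).
Proof.
have Rconj := @reflections_conj _ W n rV.
split; first exact: lieH_tail0E.
by split; [exact: lie_center_odd0|exact: lieH_tail1E].
Qed.
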